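(* Let $n\ge 2$. There is a full $(n+1)$-coloring $\Gamma$ of $\mathbb{S}^n$ such that every great $(n-1)$-sphere $S\subset\mathbb{S}^n$ is colored using at most $n$ colors, i.e. $|\Gamma(S)|\le n$.
   Context: The standard $n$-sphere is $\mathbb{S}^n$, the unit sphere in $\mathbb{R}^{n+1}$. A full $k$-coloring of $\mathbb{S}^n$ is a surjective map $\Gamma:\mathbb{S}^n\to\{1,\dots,k\}$; no regularity is assumed. A great $(n-1)$-sphere is the intersection of $\mathbb{S}^n$ with a hyperplane of $\mathbb{R}^{n+1}$ passing through the origin (an $n$-dimensional linear subspace). *)

(* Defs.v *)
From mathcomp Require Import all_boot all_order all_algebra.
From mathcomp Require Import all_classical all_reals.

Set Implicit Arguments.
Unset Strict Implicit.
Unset Printing Implicit Defensive.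

Import Order.TTheory GRing.Theory Num.Theory.

Local Open Scope classical_set_scope.
Local Open Scope ring_scope.

(* The norm that MathComp-Analysis puts on matrices is the sup norm, so the
   Euclidean one is written out. *)
Definition unit_sphere (R : realType) (n : nat) : set 'rV[R]_n.+1 :=
  [set x | \sum_(i < n.+1) x 0 i ^+ 2 = 1].
Arguments unit_sphere : clear implicits.

(* unit_sphere R n is used as a type through the coercion set_type; the
   colors 1, ..., k are represented by the elements 0, ..., k - 1 of 'I_k. *)
Definition full_coloring (R : realType) (n k : nat)
    (Gamma : unit_sphere R n -> 'I_k) : Prop :=
  forall c : 'I_k, exists x : unit_sphere R n, Gamma x = c.

Definition great_hypersphere (R : realType) (n : nat)
    (S : set (unit_sphere R n)) : Prop :=
  exists2 H : {vspace 'rV[R]_n.+1},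
    \dim H = n & S = [set x : unit_sphere R n | \val x \in H].

(* Main.v *)
Require Import Defs.
From mathcomp Require Import all_boot all_order all_algebra.
From mathcomp Require Import all_classical all_reals.

(** Color a point by the position of its last nonzero coordinate; in other
    words, color the points of [V_(i+1) \ V_i] with [i], where
    [V_0 < V_1 < ... < V_(n+1)] is the standard flag of coordinate subspaces.
    Along a subspace [H], the dimension of [H :&: V_i] increases exactly at the
    colors that [H] meets, so a subspace of dimension [d] meets exactly [d]
    colors. Only one consequence of this count matters here: a subspace that
    meets all the colors is the whole space ([full_of_last_support]), because
    one vector of each color yields an invertible triangular matrix. Hence a
    hyperplane misses some color, and the [n] other colors suffice for it. *)

Import GRing.Theory.

Local Open Scope classical_set_scope.
Local Open Scope ring_scope.

Section LastSupport.
Context {F : fieldType} {n : nat}.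
Implicit Types (v : 'rV[F]_n.+1) (H : {vspace 'rV[F]_n.+1}).

Definition last_support v : 'I_n.+1 :=
  inord (\max_(i < n.+1 | v 0 i != 0) i).

Lemma val_last_support v :
  last_support v = \max_(i < n.+1 | v 0 i != 0) i :> nat.
Proof.
by rewrite inordK // ltnS; apply/bigmax_leqP => i _; rewrite -ltnS.
Qed.

Lemma last_support_neq0 {v} : v != 0 -> v 0 (last_support v) != 0.
Proof.
move=> /rV0Pn[i vi].
have supp_gt0 : (0 < #|[pred i | v 0%R i != 0%R]|)%N by apply/card_gt0P; exists i.
have [j vj max_j] := eq_bigmax_cond (fun i : 'I_n.+1 => i : nat) supp_gt0.
by have -> : last_support v = j by apply: val_inj; rewrite /= val_last_support.
Qed.

Lemma gt_last_support v (j : 'I_n.+1) :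
  (last_support v < j)%N -> v 0 j = 0.
Proof.
rewrite val_last_support ltnNge => /negP vj; apply/eqP/negP => /negP vj0.
by apply: vj; apply: (leq_bigmax_cond (F := fun i : 'I_n.+1 => i : nat)).
Qed.

Lemma last_support_delta (c : 'I_n.+1) : last_support (delta_mx 0 c) = c.
Proof.
have delta_neq0 : delta_mx 0 c != 0 :> 'rV[F]_n.+1.
  by apply/rV0Pn; exists c; rewrite mxE !eqxx oner_eq0.
have := last_support_neq0 delta_neq0; rewrite mxE eqxx /=.
by case: (last_support _ =P c) => //; rewrite eqxx.
Qed.

(** Stacking one vector of [H] for each position gives a lower triangular
    matrix without zeros on the diagonal; it is invertible, so its rows, which
    lie in [H], span everything. *)
Lemma full_of_last_support H :
    (forall c, exists v, [/\ v \in H, v != 0 & last_support v = c]) ->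
  H = fullv.
Proof.
move=> /choice[v vP]; pose A : 'M_n.+1 := \matrix_i v i.
have A_trig : is_trig_mx A.
  apply/is_trig_mxP => i j lt_ij; rewrite mxE.
  by apply: gt_last_support; have [_ _ ->] := vP i.
have A_unit : A \in unitmx.
  rewrite unitmxE det_trig // unitfE; apply/prodf_neq0 => i _; rewrite mxE.
  by have [_ /last_support_neq0 + last_i] := vP i; rewrite last_i.
apply/eqP; rewrite eqEsubv subvf; apply/subvP => w _.
rewrite -(mulmxKV A_unit w) mulmx_sum_row; apply: memv_suml => i _.
by apply: memvZ; rewrite rowK; have [] := vP i.
Qed.

End LastSupport.

Lemma unit_sphere_neq0 {R : realType} {n : nat} (x : unit_sphere R n) :
  \val x != 0.
Proof.
apply/eqP => x0; have := set_valP x; rewrite /unit_sphere /= x0.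
rewrite big1 => [/esym/eqP|i _]; first by rewrite oner_eq0.
by rewrite mxE expr0n.
Qed.

Lemma delta_unit_sphere {R : realType} {n : nat} (c : 'I_n.+1) :
  unit_sphere R n (delta_mx 0 c).
Proof.
rewrite /unit_sphere /= (bigD1 c) //= big1 => [|i /negPf ic].
  by rewrite mxE !eqxx expr1n addr0.
by rewrite mxE ic andbF expr0n.
Qed.

Lemma card_le_ord_missing {n : nat} (c : 'I_n.+1) (A : set 'I_n.+1) :
  ~ A c -> (A #<= `I_n)%card.
Proof.
move=> Ac; pose f (k : nat) : 'I_n.+1 := inord (bump c k).
apply: (@card_le_trans _ _ _ (f @` `I_n)); last exact: card_image_le.
apply: subset_card_le => i Ai.
have : c != i by apply: contra_not_neq Ac => ->.
move=> /unlift_some[k -> _]; exists (k : nat); first exact: ltn_ord.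
by apply: val_inj; rewrite /= inordK //; apply: (ltn_ord (lift c k)).
Qed.

Theorem proposition5p1 (R : realType) (n : nat) (hn : (2 <= n)%N) :
  exists Gamma : unit_sphere R n -> 'I_n.+1,
    full_coloring Gamma /\
    forall S : set (unit_sphere R n), great_hypersphere S ->
      (Gamma @` S #<= `I_n)%card.
Proof.
exists (fun x => last_support (\val x)); split=> [c | _ [H dimH ->]].
  exists (exist _ (delta_mx 0 c) (mem_set (delta_unit_sphere c))) => /=.
  exact: last_support_delta.
have [c missed] : exists c : 'I_n.+1,
    ~ exists x : unit_sphere R n, \val x \in H /\ last_support (\val x) = c.
  apply/existsNP => all_colors.
  have HT : H = fullv.
    apply: full_of_last_support => c; have [x [xH xc]] := all_colors c.
    by exists (\val x); split=> //; apply: unit_sphere_neq0.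
  by move: dimH; rewrite HT dimvf dim_matrix mul1r => /esym/n_Sn.
apply: (card_le_ord_missing c) => -[x xH xc].
by apply: missed; exists x.
Qed.
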